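(* Let $\mathbb K$ be a field of characteristic zero. Up to conjugation in $\mathrm{PGL}_2(\mathbb K)$, any $\mathbb K$-Borel subgroup of $\mathrm{PGL}_2(\mathbb K)$ is equal to either $\mathrm{Aff}_1(\mathbb K)$ or $\mathbb T_f$ for some nonsquare element $f$ of $\mathbb K$. Moreover, any subgroup of $\mathrm{PGL}_2(\mathbb K)$ that is closed, connected (for the $\mathbb K$-topology) and solvable is contained in a $\mathbb K$-Borel subgroup.
   Context: For an affine variety $V$ defined over $\mathbb K$, the $\mathbb K$-topology on $V(\mathbb K)$ is the topology whose closed sets are the zero sets in $V(\mathbb K)$ of collections of elements of the affine algebra $\mathbb K[V]$. For a linear algebraic group $G$ defined over $\mathbb K$, a $\mathbb K$-Borel subgroup of $G(\mathbb K)$ is a subgroup of $G(\mathbb K)$ which is maximal among the closed connected solvable subgroups of $G(\mathbb K)$ for the $\mathbb K$-topology. $\mathrm{Aff}_1(\mathbb K)=\left\{\begin{pmatrix}a&b\\0&1\end{pmatrix}: a\in\mathbb K^*, b\in\mathbb K\right\}\subseteq\mathrm{PGL}_2(\mathbb K)$. For a nonsquare $f\in\mathbb K$, $\mathbb T_f=\left\{\begin{pmatrix}a&bf\\ b&a\end{pmatrix}: a,b\in\mathbb K,\ (a,b)\neq(0,0)\right\}\subseteq\mathrm{PGL}_2(\mathbb K)$ (classes of matrices). *)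

(* Defs.v *)
From HB Require Import structures.
From mathcomp Require Import all_boot all_order all_algebra.
From mathcomp Require Import generic_quotient.
From mathcomp Require Import mpoly.
From mathcomp Require Import boolp classical_sets topology.
Set Implicit Arguments.
Unset Strict Implicit.
Unset Printing Implicit Defensive.
Import GRing.Theory.
Local Open Scope classical_set_scope.
Local Open Scope ring_scope.
Local Open Scope quotient_scope.

(* The library notions of subgroup and solvability concern finite groups only. *)
Section Subgroups.
Variable G : groupType.
Implicit Types H : set G.

Definition subgroup H : Prop := group_closed (mem H).

Definition derived H : set G :=
  smallest subgroup [set [~ x, y]%g | x in H & y in H].

Definition is_solvable H : Prop := exists n, iter n derived H = [set 1%g].

Definition conjugate (g : G) H : set G := [set (x ^ g)%g | x in H].

End Subgroups.

Section GL2.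
Variable K : fieldType.

Record GL2 : Type := MkGL2 {
  gl2_val :> 'M[K]_2;
  gl2_unit : gl2_val \in unitmx
}.
HB.instance Definition _ := [isSub for gl2_val].
HB.instance Definition _ := [Choice of GL2 by <:].

Definition gl2_one : GL2 := MkGL2 (unitmx1 K 2).

Fact gl2_mul_subproof (M N : GL2) : M *m N \in unitmx.
Proof. by rewrite unitmx_mul !gl2_unit. Qed.
Definition gl2_mul (M N : GL2) : GL2 := MkGL2 (gl2_mul_subproof M N).

Fact gl2_inv_subproof (M : GL2) : invmx M \in unitmx.
Proof. by rewrite unitmx_inv gl2_unit. Qed.
Definition gl2_inv (M : GL2) : GL2 := MkGL2 (gl2_inv_subproof M).

Fact gl2_mulA : associative gl2_mul.
Proof. by move=> M N P; apply: val_inj; exact: mulmxA. Qed.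
Fact gl2_mul1 : left_id gl2_one gl2_mul.
Proof. by move=> M; apply: val_inj; exact: mul1mx. Qed.
Fact gl2_mulr1 : right_id gl2_one gl2_mul.
Proof. by move=> M; apply: val_inj; exact: mulmx1. Qed.
Fact gl2_mulV : left_inverse gl2_one gl2_inv gl2_mul.
Proof. by move=> M; apply: val_inj; exact: mulVmx (gl2_unit M). Qed.
Fact gl2_mulrV : right_inverse gl2_one gl2_inv gl2_mul.
Proof. by move=> M; apply: val_inj; exact: mulmxV (gl2_unit M). Qed.

HB.instance Definition _ :=
  isGroup.Build GL2 gl2_mulA gl2_mul1 gl2_mulr1 gl2_mulV gl2_mulrV.

Definition proportional (M N : GL2) : bool :=
  `[< exists2 c : K, c != 0 & gl2_val M = c *: gl2_val N >].

Fact proportional_refl : reflexive proportional.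
Proof. by move=> M; apply/asboolP; exists 1; rewrite ?oner_eq0 ?scale1r. Qed.

Fact proportional_sym : ssrbool.symmetric proportional.
Proof.
suff H M N : proportional M N -> proportional N M.
  by move=> M N; apply/idP/idP; exact: H.
move=> /asboolP[c c0 e]; apply/asboolP; exists c^-1; first by rewrite invr_eq0.
by rewrite e scalerA mulVf// scale1r.
Qed.

Fact proportional_trans : transitive proportional.
Proof.
move=> N M P /asboolP[c c0 e] /asboolP[d d0 e']; apply/asboolP.
by exists (c * d); rewrite ?mulf_neq0// e e' scalerA.
Qed.

Canonical proportional_equiv := EquivRel proportional
  proportional_refl proportional_sym proportional_trans.

Definition PGL2 : Type := {eq_quot proportional_equiv}.
HB.instance Definition _ := Choice.on PGL2.
HB.instance Definition _ := EqQuotient.on PGL2.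

Definition pgl2_class (M : GL2) : PGL2 := \pi_PGL2 M.

Lemma pgl2_class_eq (M N : GL2) : pgl2_class M = pgl2_class N <->
  exists2 c : K, c != 0 & gl2_val M = c *: gl2_val N.
Proof.
split=> [/eqP|h]; first by rewrite eqmodE => /asboolP.
by apply/eqP; rewrite eqmodE; apply/asboolP.
Qed.

Definition pgl2_mul (x y : PGL2) : PGL2 :=
  pgl2_class (gl2_mul (repr x) (repr y)).
Definition pgl2_inv (x : PGL2) : PGL2 := pgl2_class (gl2_inv (repr x)).
Definition pgl2_one : PGL2 := pgl2_class gl2_one.

Lemma pgl2_ind (P : PGL2 -> Prop) : (forall M, P (pgl2_class M)) -> forall x, P x.
Proof. by move=> h x; rewrite -[x]reprK; exact: h. Qed.

Lemma repr_class (M : GL2) :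
  exists2 c : K, c != 0 & gl2_val (repr (pgl2_class M)) = c *: gl2_val M.
Proof. by apply/pgl2_class_eq; exact: reprK. Qed.

Lemma pgl2_mulE (M N : GL2) :
  pgl2_mul (pgl2_class M) (pgl2_class N) = pgl2_class (gl2_mul M N).
Proof.
have [c c0 e] := repr_class M; have [d d0 e'] := repr_class N.
apply/pgl2_class_eq; exists (c * d); first exact: mulf_neq0.
change (gl2_val (repr (pgl2_class M)) *m gl2_val (repr (pgl2_class N)) =
  (c * d) *: (gl2_val M *m gl2_val N)).
by rewrite e e' -scalemxAl -scalemxAr scalerA.
Qed.

Lemma pgl2_invE (M : GL2) : pgl2_inv (pgl2_class M) = pgl2_class (gl2_inv M).
Proof.
have [c c0 e] := repr_class M.
apply/pgl2_class_eq; exists c^-1; first by rewrite invr_eq0.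
change (invmx (gl2_val (repr (pgl2_class M))) = c^-1 *: invmx (gl2_val M)).
by rewrite e invmxZ// unitmxZ ?unitfE// (gl2_unit M).
Qed.

Fact pgl2_mulA : associative pgl2_mul.
Proof.
elim/pgl2_ind=> M; elim/pgl2_ind=> N; elim/pgl2_ind=> P.
by rewrite !pgl2_mulE gl2_mulA.
Qed.
Fact pgl2_mul1 : left_id pgl2_one pgl2_mul.
Proof. by elim/pgl2_ind=> M; rewrite pgl2_mulE gl2_mul1. Qed.
Fact pgl2_mulr1 : right_id pgl2_one pgl2_mul.
Proof. by elim/pgl2_ind=> M; rewrite pgl2_mulE gl2_mulr1. Qed.
Fact pgl2_mulV : left_inverse pgl2_one pgl2_inv pgl2_mul.
Proof. by elim/pgl2_ind=> M; rewrite pgl2_invE pgl2_mulE gl2_mulV. Qed.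
Fact pgl2_mulrV : right_inverse pgl2_one pgl2_inv pgl2_mul.
Proof. by elim/pgl2_ind=> M; rewrite pgl2_invE pgl2_mulE gl2_mulrV. Qed.

HB.instance Definition _ :=
  isGroup.Build PGL2 pgl2_mulA pgl2_mul1 pgl2_mulr1 pgl2_mulV pgl2_mulrV.

(* PGL_2 is the complement of the quadric det = 0 in the projective space of
   2 x 2 matrices, so its affine algebra consists of the quotients P / det^n
   with P homogeneous of degree 2n in the four matrix entries (mxvec lists
   them in the order 00, 01, 10, 11). *)
Definition regular_fun (f : PGL2 -> K) : Prop :=
  exists n, exists2 P : {mpoly K[2 * 2]},
    P \is (2 * n)%N.-homog &
    forall M : GL2, f (pgl2_class M) =
      P.@[mxvec M 0] / \det M ^+ n.

Definition zero_set (S : set (PGL2 -> K)) : set PGL2 :=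
  [set x | forall f, S f -> f x = 0].

Definition K_closed (A : set PGL2) : Prop :=
  exists2 S : set (PGL2 -> K), S `<=` regular_fun & A = zero_set S.

Fact regular1 : regular_fun (fun=> 1).
Proof.
exists 0%N, 1; first by rewrite muln0; exact: dhomog1.
by move=> M; rewrite meval1 expr0 divr1.
Qed.

Fact regularM f g : regular_fun f -> regular_fun g -> regular_fun (fun x => f x * g x).
Proof.
move=> [m [P hP fP]] [n [Q hQ gQ]]; exists (m + n)%N, (P * Q).
  by rewrite mulnDr; exact: dhomogM.
by move=> M; rewrite fP gQ mevalM exprD invfM mulrACA.
Qed.

Fact K_openT : K_closed (~` setT).
Proof.
exists [set fun=> 1]; first by move=> _ ->; exact: regular1.
apply/seteqP; split=> x; first by move=> /(_ I).
by move=> /(_ _ erefl)/eqP; rewrite oner_eq0.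
Qed.

Fact K_openI : setI_closed [set U | K_closed (~` U)].
Proof.
move=> U V [S Sr US] [T Tr VT]; rewrite /= setCI US VT.
exists [set h | exists f g, [/\ S f, T g & h = (fun x => f x * g x)]].
  by move=> _ [f [g [Sf Tg ->]]]; apply: regularM; [exact: Sr|exact: Tr].
apply/seteqP; split=> x.
  by move=> [Sx|Tx] _ [f [g [Sf Tg ->]]];
     rewrite ?(Sx f Sf) ?(Tx g Tg) ?mul0r ?mulr0.
move=> h; have [Sx|] := pselect (zero_set S x); first by left.
move=> /existsNP[f /not_implyP[Sf /eqP fx]]; right=> g Tg.
have /eqP := h _ (ex_intro _ f (ex_intro _ g (And3 Sf Tg erefl))).
by rewrite mulf_eq0 (negbTE fx) => /eqP.
Qed.

Fact K_open_bigU (J : Type) (F : J -> set PGL2) :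
  (forall i, [set U | K_closed (~` U)] (F i)) ->
  [set U | K_closed (~` U)] (\bigcup_i F i).
Proof.
move=> FK; rewrite /= setC_bigcup.
exists [set f | exists2 S : set (PGL2 -> K), S `<=` regular_fun &
                exists2 i, ~` F i = zero_set S & S f].
  by move=> f [S Sr [i _]]; exact: Sr.
apply/seteqP; split=> x.
  by move=> Fx f [S _ [i FS]]; have := Fx i I; rewrite FS; exact.
move=> h i _; have [S Sr FS] := FK i; rewrite FS => f Sf.
by apply: h; exists S => //; exists i.
Qed.

HB.instance Definition _ :=
  isOpenTopological.Build PGL2 K_openT K_openI K_open_bigU.

Lemma K_closedE (A : set PGL2) : closed A <-> K_closed A.
Proof. by rewrite -openC -{2}(setCK A). Qed.

Definition closed_connected_solvable (H : set PGL2) : Prop :=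
  [/\ subgroup H, closed H, connected H & is_solvable H].

Definition K_Borel (B : set PGL2) : Prop :=
  closed_connected_solvable B /\
  forall H, closed_connected_solvable H -> B `<=` H -> H = B.

Definition mx2 (a b c d : K) : 'M[K]_2 :=
  \matrix_(i, j) if i == 0 then (if j == 0 then a else b)
                 else (if j == 0 then c else d).

Definition Aff1 : set PGL2 :=
  [set x | exists (M : GL2) (a b : K),
    [/\ a != 0, gl2_val M = mx2 a b 0 1 & x = pgl2_class M]].

(* For f nonsquare, each matrix mx2 a (b * f) b a with (a, b) != (0, 0) is
   invertible, so quantifying over GL2 loses none of them. *)
Definition torus (f : K) : set PGL2 :=
  [set x | exists (M : GL2) (a b : K),
    [/\ (a, b) != (0, 0), gl2_val M = mx2 a (b * f) b a & x = pgl2_class M]].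

End GL2.

Arguments Aff1 K : clear implicits.

(* Main.v *)
Require Import Defs.
From mathcomp Require Import all_boot all_order all_algebra.
From mathcomp Require Import mpoly ring.
From mathcomp Require Import boolp classical_sets topology.
Set Implicit Arguments.
Unset Strict Implicit.
Unset Printing Implicit Defensive.
Import GRing.Theory.
Local Open Scope classical_set_scope.
Local Open Scope ring_scope.

(* Let H be closed, connected and solvable, and nontrivial. A nontrivial element
   [M] of the last nontrivial term of its derived series commutes in PGL_2 with
   all its H-conjugates. Connectedness makes M commute with them as matrices, so
   the traceless part A of M is sent to a multiple of itself by conjugation by
   any [N] in H. If det A = 0, then H fixes the line ker A. Otherwise that
   multiple is a sign, and by connectedness again H centralizes A; so H fixes an
   eigenline of A if -det A is a square, and lies in the torus centralizing A if
   not. Hence H lies in the stabilizer of a line or in such a torus. Both are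
   closed and solvable, are connected because they come from linear subspaces of
   matrices, whose points are joined to 1 by lines, and no two of them are
   strictly included in one another: they are exactly the K-Borel subgroups. *)

(** * Derived series and solvability in abstract groups *)

Section Groups.
Variable G : groupType.
Implicit Types (H A B : set G) (x y g h : G).

Lemma subgroupP H :
  subgroup H <-> H 1%g /\ forall x y, H x -> H y -> H (x * y^-1)%g.
Proof.
rewrite /subgroup /group_closed; split=> -[h1 hd]; split.
- exact/set_mem.
- by move=> x y Hx Hy; apply/set_mem/hd; exact/mem_set.
- exact/mem_set.
- by move=> x y /set_mem Hx /set_mem Hy; apply/mem_set/hd.
Qed.

Lemma subgroup1 H : subgroup H -> H 1%g.
Proof. by case/subgroupP. Qed.

Lemma subgroupV H x : subgroup H -> H x -> H x^-1%g.
Proof. by case/subgroupP=> H1 HB Hx; rewrite -[x^-1%g]mul1g; exact: HB. Qed.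

Lemma subgroupM H x y : subgroup H -> H x -> H y -> H (x * y)%g.
Proof.
move=> sH Hx Hy; rewrite -[y]invgK.
by case/subgroupP: (sH) => _; apply=> //; exact: subgroupV.
Qed.

Lemma subgroupR H x y : subgroup H -> H x -> H y -> H [~ x, y]%g.
Proof.
by move=> sH Hx Hy; rewrite commgEl conjgE; do ?[exact: subgroupV|apply: subgroupM].
Qed.

Lemma subgroup_conjgV H g : subgroup H -> subgroup [set x | H (x ^ g)%g].
Proof.
move=> sH; apply/subgroupP; split=> [|x y /= Hx Hy].
  by rewrite /= conj1g; exact: subgroup1.
by rewrite conjMg conjVg; apply: subgroupM => //; exact: subgroupV.
Qed.

Lemma subgroup_set1 : subgroup [set 1%g : G].
Proof. by apply/subgroupP; split=> // x y -> ->; rewrite /= invg1 mulg1. Qed.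

Lemma derived_subgroup H : subgroup (derived H).
Proof.
apply/subgroupP; split=> [B [sB _]|x y Hx Hy B BH]; first exact: subgroup1.
apply: subgroupM; first by case: BH.
  exact: Hx.
by apply: subgroupV; [case: BH|exact: Hy].
Qed.

Lemma derived_commg H x y : H x -> H y -> derived H [~ x, y]%g.
Proof. by move=> Hx Hy B [_]; apply; exists x => //; exists y. Qed.

Lemma derived_min H B : subgroup B ->
  (forall x y, H x -> H y -> B [~ x, y]%g) -> derived H `<=` B.
Proof. by move=> sB HB x; apply; split=> // _ [u Hu] [v Hv] <-; exact: HB. Qed.

Lemma derivedS H B : H `<=` B -> derived H `<=` derived B.
Proof.
move=> HB; apply: derived_min => [|x y Hx Hy]; first exact: derived_subgroup.
by apply: derived_commg; exact: HB.
Qed.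

Lemma derived_sub H : subgroup H -> derived H `<=` H.
Proof. by move=> sH; apply: derived_min => // x y; exact: subgroupR. Qed.

Lemma iter_derived_subgroup n H : subgroup H -> subgroup (iter n (@derived G) H).
Proof. by case: n => //= n _; exact: derived_subgroup. Qed.

Lemma iter_derived_sub n H : subgroup H -> iter n (@derived G) H `<=` H.
Proof.
move=> sH; elim: n => //= n IH x xn.
exact: IH (derived_sub (iter_derived_subgroup n sH) xn).
Qed.

(** This keeps the [H]-conjugates of an element of a derived term inside that term, so that they
    commute once the next term is trivial. *)
Lemma iter_derived_conjg n H g : (forall x, H x -> H (x ^ g)%g) ->
  forall x, iter n (@derived G) H x -> iter n (@derived G) H (x ^ g)%g.
Proof.
move=> Hg; elim: n => //= n IH.
apply: (@derived_min _ [set x | derived (iter n (@derived G) H) (x ^ g)%g]).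
  exact: subgroup_conjgV (derived_subgroup _).
by move=> x y Hx Hy; rewrite /= conjRg; apply: derived_commg; exact: IH.
Qed.

Lemma abelian_is_solvable H : H 1%g ->
  (forall x y, H x -> H y -> commute x y) -> is_solvable H.
Proof.
move=> H1 ab; exists 1%N => /=; apply/seteqP; split; last first.
  by move=> _ ->; exact: subgroup1 (derived_subgroup _).
apply: derived_min; first exact: subgroup_set1.
by move=> x y Hx Hy; apply/eqP/commgP/ab.
Qed.

(** Commutators of [H] fall into the abelian [B], so the second derived subgroup is trivial. *)
Lemma metabelian_is_solvable H B : B 1%g ->
  subgroup B -> (forall x y, H x -> H y -> B [~ x, y]%g) ->
  (forall x y, B x -> B y -> commute x y) -> is_solvable H.
Proof.
move=> B1 sB HB ab; exists 2%N => /=; apply/seteqP; split; last first.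
  by move=> _ ->; exact: subgroup1 (derived_subgroup _).
apply: subset_trans (derivedS (derived_min sB HB)) _.
apply: derived_min; first exact: subgroup_set1.
by move=> x y Hx Hy; apply/eqP/commgP/ab.
Qed.

(* Any nontrivial element of the last nontrivial term of the derived series works. *)
Lemma solvable_commuting_conjugates H : subgroup H -> is_solvable H ->
  H `<=` [set 1%g] \/
  exists x, [/\ H x, x <> 1%g & forall h, H h -> commute (x ^ h)%g x].
Proof.
move=> sH solH; have exn : exists n, `[< iter n (@derived G) H = [set 1%g] >].
  by case: solH => n Hn; exists n; apply/asboolP.
case: (ex_minnP exn) => -[|n] /asboolP Hn minn; first by left; rewrite -Hn.
right; set A := iter n (@derived G) H; have sA : subgroup A.
  exact: iter_derived_subgroup.
have [x Ax x1] : exists2 x, A x & x <> 1%g.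
  apply: contrapT => /forall2NP A1.
  suff /asboolP/minn : iter n (@derived G) H = [set 1%g] by rewrite ltnn.
  apply/seteqP; split=> [x Ax|_ ->]; last exact: subgroup1.
  by case: (A1 x) => // /contrapT.
exists x; split=> //; first by apply: iter_derived_sub Ax.
move=> h Hh; have Axh : A (x ^ h)%g.
  apply: iter_derived_conjg Ax => y Hy; rewrite conjgE.
  by do ?[exact: subgroupV|apply: subgroupM].
by apply/commgP/eqP; suff: [set 1%g] [~ x ^ h, x]%g by []; rewrite -Hn; exact: derived_commg.
Qed.

End Groups.

(** * Explicit 2 by 2 matrices and the adjugate *)

Section Matrices2.
Variable K : fieldType.
Implicit Types (A B M : 'M[K]_2) (a b c d : K).

Lemma mx2E A : A = mx2 (A 0 0) (A 0 1) (A 1 0) (A 1 1).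
Proof.
apply/matrixP=> i j; rewrite mxE.
by case: (boolP (i == 0)) => [/eqP->|]; case: (boolP (j == 0)) => [/eqP->|];
  case: i => [[|[|]]]// ?; case: j => [[|[|]]]// ? _; do 2?move=> _;
  congr (A _ _); apply: val_inj.
Qed.

Lemma mx2_ind (P : 'M[K]_2 -> Prop) : (forall a b c d, P (mx2 a b c d)) -> forall A, P A.
Proof. by move=> h A; rewrite (mx2E A). Qed.

Lemma mx2_inj a b c d a' b' c' d' : mx2 a b c d = mx2 a' b' c' d' ->
  [/\ a = a', b = b', c = c' & d = d'].
Proof.
move=> e; have eE i j : mx2 a b c d i j = mx2 a' b' c' d' i j by rewrite e.
by split; [move: (eE 0 0)|move: (eE 0 1)|move: (eE 1 0)|move: (eE 1 1)]; rewrite !mxE.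
Qed.

Lemma mulmx2 a b c d a' b' c' d' : mx2 a b c d *m mx2 a' b' c' d' =
  mx2 (a * a' + b * c') (a * b' + b * d') (c * a' + d * c') (c * b' + d * d').
Proof.
rewrite [LHS]mx2E; congr mx2;
  by rewrite !mxE !big_ord_recl big_ord0 !mxE /= addr0.
Qed.

Lemma addmx2 a b c d a' b' c' d' : mx2 a b c d + mx2 a' b' c' d' =
  mx2 (a + a') (b + b') (c + c') (d + d').
Proof. by rewrite [LHS]mx2E; congr mx2; rewrite !mxE. Qed.

Lemma oppmx2 a b c d : - mx2 a b c d = mx2 (- a) (- b) (- c) (- d).
Proof. by rewrite [LHS]mx2E; congr mx2; rewrite !mxE. Qed.

Lemma scalemx2 k a b c d : k *: mx2 a b c d = mx2 (k * a) (k * b) (k * c) (k * d).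
Proof. by rewrite [LHS]mx2E; congr mx2; rewrite !mxE. Qed.

Lemma scalar_mx2 a : a%:M = mx2 a 0 0 a.
Proof. by rewrite [LHS]mx2E; congr mx2; rewrite !mxE. Qed.

Lemma mx2_0 : 0 = mx2 0 0 0 0 :> 'M[K]_2.
Proof. by rewrite [LHS]mx2E; congr mx2; rewrite !mxE. Qed.

Lemma trace_mx2 a b c d : \tr (mx2 a b c d) = a + d.
Proof. by rewrite /mxtrace !big_ord_recl big_ord0 !mxE /= addr0. Qed.

Lemma det_mx2 a b c d : \det (mx2 a b c d) = a * d - b * c.
Proof.
rewrite (expand_det_row _ 0) !big_ord_recl big_ord0 /cofactor !det_mx11 !mxE /=.
by rewrite /bump /= addr0 add0n addn0 expr0 expr1 mul1r mulN1r mulrN.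
Qed.

(** The adjugate, as given by Cayley-Hamilton in size 2. Being linear in [A], it is a polynomial
    substitute for the inverse, from which it differs by a scalar on invertible matrices. *)
Definition adj2 A : 'M[K]_2 := (\tr A)%:M - A.

Lemma mul_adj2 A : adj2 A *m A = (\det A)%:M.
Proof.
elim/mx2_ind: A => a b c d; rewrite /adj2 trace_mx2 det_mx2 !scalar_mx2.
by rewrite oppmx2 addmx2 mulmx2; congr mx2; ring.
Qed.

Lemma adj2_unit A : A \in unitmx -> adj2 A = \det A *: invmx A.
Proof. by move=> uA; rewrite -[LHS](mulmxK uA) mul_adj2 mul_scalar_mx. Qed.

End Matrices2.

(** * Homogeneous polynomial maps on matrices *)

Section HomogeneousMaps.
Variable K : fieldType.
Implicit Types (N A B : 'M[K]_2).

Definition homog_fun (d : nat) (F : 'M[K]_2 -> K) : Prop :=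
  exists2 P : {mpoly K[2 * 2]}, P \is d.-homog & forall N, F N = P.@[mxvec N 0].

Definition homog_mx (d m n : nat) (F : 'M[K]_2 -> 'M[K]_(m, n)) : Prop :=
  forall i j, homog_fun d (fun N => F N i j).

Lemma homog_fun_scale d F c N : homog_fun d F -> F (c *: N) = c ^+ d * F N.
Proof.
move=> [P hP FP]; rewrite !FP !mevalE mulr_sumr !big_seq.
apply: eq_bigr => m mP; rewrite mulrCA; congr (_ * _).
rewrite -(dhomog_mf hP mP) /= mdegE -prodrXr -big_split /=.
by apply: eq_bigr => i _; rewrite linearZ mxE exprMn.
Qed.

Lemma homog_funD d F G : homog_fun d F -> homog_fun d G ->
  homog_fun d (fun N => F N + G N).
Proof.
move=> [P hP FP] [Q hQ GQ]; exists (P + Q); first exact: dhomogD.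
by move=> N; rewrite FP GQ mevalD.
Qed.

Lemma homog_funN d F : homog_fun d F -> homog_fun d (fun N => - F N).
Proof.
move=> [P hP FP]; exists (- P); first by rewrite dhomogN.
by move=> N; rewrite FP mevalN.
Qed.

Lemma homog_funM d e F G : homog_fun d F -> homog_fun e G ->
  homog_fun (d + e) (fun N => F N * G N).
Proof.
move=> [P hP FP] [Q hQ GQ]; exists (P * Q); first exact: dhomogM.
by move=> N; rewrite FP GQ mevalM.
Qed.

Lemma homog_fun0 d : homog_fun d (fun=> 0).
Proof. by exists 0; [exact: dhomog0|move=> N; rewrite meval0]. Qed.

Lemma homog_fun_cst c : homog_fun 0 (fun=> c).
Proof.
exists (c *: 1); first exact/dhomogZ/dhomog1.
by move=> N; rewrite mevalZ meval1 mulr1.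
Qed.

Lemma homog_fun_sum d (I : Type) (r : seq I) (F : I -> 'M[K]_2 -> K) :
  (forall i, homog_fun d (F i)) -> homog_fun d (fun N => \sum_(i <- r) F i N).
Proof.
move=> hF; elim: r => [|i r IH].
  have -> : (fun N => \sum_(i <- [::]) F i N) = (fun=> 0); last exact: homog_fun0.
  by apply/funext => N; rewrite big_nil.
have -> : (fun N => \sum_(j <- i :: r) F j N) = (fun N => F i N + \sum_(j <- r) F j N).
  by apply/funext => N; rewrite big_cons.
exact: homog_funD.
Qed.

Lemma homog_mx_id : homog_mx 1 (@id 'M[K]_2).
Proof.
move=> i j; exists 'X_(mxvec_index i j); first by rewrite dhomogX /= mdeg1.
by move=> N; rewrite mevalXU mxvecE.
Qed.

Lemma homog_mx_cst m n (A : 'M[K]_(m, n)) : homog_mx 0 (fun=> A).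
Proof. by move=> i j; exact: homog_fun_cst. Qed.

Lemma homog_mxB d m n (F G : 'M[K]_2 -> 'M[K]_(m, n)) :
  homog_mx d F -> homog_mx d G -> homog_mx d (fun N => F N - G N).
Proof.
move=> hF hG i j.
have -> : (fun N => (F N - G N) i j) = (fun N => F N i j + - G N i j).
  by apply/funext => N; rewrite !mxE.
by apply: homog_funD => //; exact: homog_funN.
Qed.

Lemma homog_mxM d e m n p (F : 'M[K]_2 -> 'M[K]_(m, n)) (G : 'M[K]_2 -> 'M[K]_(n, p)) :
  homog_mx d F -> homog_mx e G -> homog_mx (d + e) (fun N => F N *m G N).
Proof.
move=> hF hG i j.
have -> : (fun N => (F N *m G N) i j) = (fun N => \sum_k F N i k * G N k j).
  by apply/funext => N; rewrite !mxE.
by apply: homog_fun_sum => k; exact: homog_funM.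
Qed.

Lemma homog_mx_adj2 : homog_mx 1 (@adj2 K).
Proof.
apply: homog_mxB homog_mx_id => i j.
have -> : (fun N : 'M[K]_2 => (\tr N)%:M i j) = (fun N => \sum_k N k k * (i == j)%:R).
  by apply/funext => N; rewrite mxE -mulr_suml mulr_natr.
apply: homog_fun_sum => k.
exact: (@homog_funM 1 0 _ _ (homog_mx_id k k) (homog_fun_cst _)).
Qed.

Lemma homog_fun_det : homog_fun 2 (fun N => \det N).
Proof.
have -> : (fun N : 'M[K]_2 => \det N) = (fun N => (adj2 N *m N) 0 0).
  by apply/funext => N; rewrite mul_adj2 mxE.
exact: (homog_mxM homog_mx_adj2 homog_mx_id).
Qed.

(** Expanding [P] at the entries of [A + t *: B] gives a polynomial in [t]; this reduces the
    connectedness of a line to polynomials in one variable. *)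
Lemma homog_fun_line d F A B : homog_fun d F ->
  exists p : {poly K}, forall t, p.[t] = F (A + t *: B).
Proof.
move=> [P _ FP].
suff [p pP] : exists p : {poly K}, forall t, p.[t] = P.@[mxvec (A + t *: B) 0].
  by exists p => t; rewrite pP FP.
exists (\sum_(m <- msupp P) P@_m *:
  \prod_i ((mxvec A 0 i)%:P + 'X * (mxvec B 0 i)%:P) ^+ m i) => t.
rewrite horner_sum mevalE; apply: eq_bigr => m _; rewrite hornerZ horner_prod.
congr (_ * _); apply: eq_bigr => i _.
by rewrite horner_exp !hornerE linearD linearZ !mxE.
Qed.

End HomogeneousMaps.

(** * Subsets of PGL_2 cut out by conditions on matrices *)

Section Classes.
Variable K : fieldType.
Implicit Types (V : 'M[K]_2 -> Prop) (M N : GL2 K) (A B : 'M[K]_2).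

Definition classes V : set (PGL2 K) :=
  [set x | exists2 N : GL2 K, V N & x = pgl2_class N].

Definition scale_invariant V := forall c A, V A -> V (c *: A).

Lemma classesE V N : scale_invariant V -> classes V (pgl2_class N) <-> V N.
Proof.
move=> sV; split=> [[M VM /pgl2_class_eq[c _ ->]]|VN]; first exact: sV.
by exists N.
Qed.

Lemma pgl2_mulgE M N : (pgl2_class M * pgl2_class N)%g = pgl2_class (M * N)%g.
Proof. exact: pgl2_mulE. Qed.

Lemma pgl2_invgE M : (pgl2_class M)^-1%g = pgl2_class M^-1%g.
Proof. exact: pgl2_invE. Qed.

Lemma pgl2_conjgE M N : (pgl2_class M ^ pgl2_class N)%g = pgl2_class (M ^ N)%g.
Proof. by rewrite !conjgE (pgl2_mulgE M N) (pgl2_invgE N) (pgl2_mulgE N^-1%g). Qed.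

Lemma gl2_val_mul M N : gl2_val (M * N)%g = gl2_val M *m gl2_val N.
Proof. by []. Qed.

Lemma gl2_val_inv M : gl2_val (M^-1)%g = invmx (gl2_val M).
Proof. by []. Qed.

Lemma homog_mx_scale d m n (F : 'M[K]_2 -> 'M[K]_(m, n)) :
  homog_mx d F -> scale_invariant (fun A => F A = 0).
Proof.
move=> hF c A FA; apply/matrixP=> i j; rewrite (homog_fun_scale c A (hF i j)) FA.
by rewrite !mxE mulr0.
Qed.

Lemma closed_classes d m n (F : 'M[K]_2 -> 'M[K]_(m, n)) :
  homog_mx d F -> closed (classes (fun A => F A = 0)).
Proof.
move=> hF; apply/K_closedE.
(* An entry of [F] has degree [d], possibly odd, while powers of the determinant have even degree.
   Its square divided by the [d]-th power of the determinant is regular and has the same zeros. *)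
pose f i j (x : PGL2 K) := F (gl2_val (repr x)) i j ^+ 2 / \det (gl2_val (repr x)) ^+ d.
have fE i j M : f i j (pgl2_class M) = F M i j ^+ 2 / \det M ^+ d.
  rewrite /f; have [c c0 ->] := repr_class M.
  rewrite detZ (homog_fun_scale c M (hF i j)) !exprMn -exprM muln2 -addnn exprD.
  by rewrite -mulf_div divff ?mul1r // mulf_neq0 ?expf_neq0.
have sF := homog_mx_scale hF.
exists [set g | exists i j, g = f i j].
  move=> _ [i [j ->]]; have [P hP FP] := hF i j.
  exists d, (P * P); first by rewrite (mul2n d) -addnn; exact: dhomogM.
  by move=> M; rewrite fE FP mevalM expr2.
apply/seteqP; split; elim/pgl2_ind=> M.
  move=> /(classesE M sF) FM _ [i [j ->]].
  by rewrite fE FM mxE expr0n mul0r.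
move=> h; apply/(classesE M sF); apply/matrixP=> i j; rewrite [RHS]mxE.
have /eqP := h _ (ex_intro _ i (ex_intro _ j erefl)).
rewrite fE mulf_eq0 invr_eq0 !expf_eq0 /=.
by have := gl2_unit M; rewrite unitmxE unitfE => /negbTE->; rewrite andbF orbF => /eqP.
Qed.

(** The zero loci of [F] and [G] are closed and disjoint and cover [H], so that of [F] is also open
    in [H]; it contains the identity. *)
Lemma connected_dichotomy (H : set (PGL2 K)) d e m n p q
    (F : 'M[K]_2 -> 'M[K]_(m, n)) (G : 'M[K]_2 -> 'M[K]_(p, q)) :
  homog_mx d F -> homog_mx e G -> connected H -> H 1%g -> F 1%:M = 0 ->
  (forall N, H (pgl2_class N) -> F N = 0 \/ G N = 0) ->
  (forall N, F N = 0 -> G N = 0 -> False) ->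
  forall N, H (pgl2_class N) -> F N = 0.
Proof.
move=> hF hG cH H1 F1 FG nFG N HN.
pose C := classes (fun A => F A = 0); pose D := classes (fun A => G A = 0).
have sF := homog_mx_scale hF; have sG := homog_mx_scale hG.
suff HC : H `&` C = H.
  by move: HN; rewrite -HC => -[_] /(classesE N sF).
apply: cH; first by exists 1%g; split=> //; apply/(classesE _ sF).
  exists (~` D); first by rewrite openC; exact: closed_classes hG.
  apply/seteqP; split; elim/pgl2_ind=> M [HM].
    move=> /(classesE M sF) FM; split=> //.
    by move=> /(classesE M sG); exact: nFG.
  move=> nDM; split=> //; apply/(classesE M sF).
  by case: (FG M HM) => // GM; case: nDM; apply/(classesE M sG).
by exists C => //; exact: closed_classes hF.
Qed.

End Classes.

(** * Connectedness of linear families in characteristic zero *)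

Section Connectedness.
Variables (K : fieldType) (charK0 : [pchar K] =i pred0).
Implicit Types (M N : GL2 K) (A B : 'M[K]_2).

Lemma poly_fun0 (p : {poly K}) : (forall t, p.[t] = 0) -> p = 0.
Proof.
(* In characteristic zero the natural numbers below [size p] are distinct roots of [p], one too many
   for its degree. *)
move=> p0; apply: (@roots_geq_poly_eq0 _ p [seq i%:R | i <- iota 0 (size p)]).
- by apply/allP => x _; apply/rootP.
- rewrite map_inj_uniq ?iota_uniq // => i j /eqP.
  wlog: i j / (i <= j)%N => [h|lij].
    by case: (leqP i j) => [/h|/ltnW/h hji] // /eqP e; apply/esym/hji; rewrite e.
  have /pcharf0P natr0 := charK0.
  rewrite eq_sym -subr_eq0 -natrB // natr0 subn_eq0 => lji.
  by apply/eqP; rewrite eqn_leq lij.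
- by rewrite size_map size_iota.
Qed.

(** The parameter is 0 at the identity and 1 at [N]. The line may contain singular matrices, which
    give no class. *)
Definition line N A := exists t, A = 1%:M + t *: (gl2_val N - 1%:M).

Lemma regular_line f N : regular_fun f -> exists p : {poly K}, exists n,
  forall M t, gl2_val M = 1%:M + t *: (gl2_val N - 1%:M) ->
  f (pgl2_class M) = p.[t] / \det M ^+ n.
Proof.
move=> [n [P hP fP]].
have [p pE] := @homog_fun_line _ (2 * n) (fun A => P.@[mxvec A 0]) 1%:M
  (gl2_val N - 1%:M) (ex_intro2 _ _ P hP (fun=> erefl)).
by exists p, n => M t eM; rewrite fP pE -eM.
Qed.

(** The line is irreducible: a proper nonempty clopen part [B] would provide regular functions [f],
    zero on [B], and [g], zero off [B], neither vanishing on the whole line although their product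
    does. *)
Lemma connected_line N : connected (classes (line N)).
Proof.
move=> B [z Bz] [O oO BO] [D cD BD].
have /K_closedE[T Treg OT] : closed (~` O) by rewrite closedC.
have /K_closedE[S Sreg DS] := cD.
apply: contrapT => BL.
have [y Ly nDy] : exists2 y, classes (line N) y & ~ D y.
  apply: contrapT => /forall2NP LD; apply: BL; rewrite BD.
  by apply/seteqP; split=> [x []//|x Lx]; split=> //; case: (LD x) => // /contrapT.
have [f Sf fy] : exists2 f, S f & f y <> 0.
  apply: contrapT => /forall2NP h; apply: nDy; rewrite DS => f Sf.
  by case: (h f) => // /contrapT.
have [g Tg gz] : exists2 g, T g & g z <> 0.
  apply: contrapT => /forall2NP h.
  have : (~` O) z by rewrite OT => g Tg; case: (h g) => // /contrapT.
  by move: Bz; rewrite BO => -[].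
have Lz : classes (line N) z by move: Bz; rewrite BO => -[].
have fg x : classes (line N) x -> f x * g x = 0.
  move=> Lx; case: (pselect (O x)) => Ox.
    have: B x by rewrite BO.
    by rewrite BD DS => -[_ /(_ f Sf)->]; rewrite mul0r.
  by have: (~` O) x by []; rewrite OT => /(_ g Tg)->; rewrite mulr0.
(* Along the line, [f * g] is a rational function of the parameter, so one of
   the two numerators is the zero polynomial. *)
have [p [n fp]] := regular_line N (Sreg f Sf).
have [r [m gr]] := regular_line N (Treg g Tg).
have [q qE] := homog_fun_line 1%:M (gl2_val N - 1%:M) (homog_fun_det K).
(* The determinant [q] along the line takes care of the parameters of singular matrices, where [fg]
   says nothing. It is not the zero polynomial, being 1 at [t = 0]. *)
have : p * r * q = 0.
  apply: poly_fun0 => t; rewrite !hornerM.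
  have [->|qt] := eqVneq q.[t] 0; first by rewrite mulr0.
  have uM : 1%:M + t *: (gl2_val N - 1%:M) \in unitmx.
    by rewrite unitmxE -qE unitfE.
  have Lt : classes (line N) (pgl2_class (MkGL2 uM)).
    by exists (MkGL2 uM) => //; exists t.
  have /eqP := fg _ Lt; rewrite (fp (MkGL2 uM) t) // (gr (MkGL2 uM) t) // -qE.
  rewrite !mulf_eq0 !invr_eq0 !expf_eq0 (negbTE qt) !andbF !orbF -mulf_eq0.
  by move=> /eqP->; rewrite mul0r.
move=> /eqP; rewrite !mulf_eq0 -orbA => /or3P[/eqP p0|/eqP r0|/eqP q0].
- by case: Ly fy => M [t Mt] -> []; rewrite (fp M t) // p0 horner0 mul0r.
- by case: Lz gz => M [t Mt] -> []; rewrite (gr M t) // r0 horner0 mul0r.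
- have := qE 0; rewrite q0 horner0 scale0r addr0 det1 => /eqP.
  by rewrite eq_sym oner_eq0.
Qed.

Lemma connected_linear_classes (V : 'M[K]_2 -> Prop) : V 1%:M ->
  (forall A B t, V A -> V B -> V (A + t *: (B - A))) -> connected (classes V).
Proof.
move=> V1 Vlin.
have -> : classes V = \bigcup_(N in [set N : GL2 K | V N]) classes (line N).
  apply/seteqP; split=> x [N VN].
    move=> ->; exists N => //; exists N => //; exists 1.
    by rewrite scale1r addrC subrK.
  by move=> [M [t Mt] ->]; exists M => //; rewrite Mt; exact: Vlin.
apply: bigcup_connected => [|N _]; last exact: connected_line.
exists 1%g => N _; exists 1%g => //.
by exists 0; rewrite scale0r addr0.
Qed.

End Connectedness.

(** * Line stabilizers and centralizers as closed subgroups *)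

Section Subgroups.
Variable K : fieldType.
Implicit Types (M N P : GL2 K) (A B : 'M[K]_2).

(** The inverse is a multiple of the adjugate and [V] ignores scalars, so closure under [adj2] gives
    closure under inversion. *)
Lemma subgroup_classes (V : 'M[K]_2 -> Prop) : V 1%:M ->
  scale_invariant V -> (forall A B, V A -> V B -> V (A *m B)) ->
  (forall A, V A -> V (adj2 A)) -> subgroup (classes V).
Proof.
move=> V1 sV VM Vadj; apply/subgroupP; split; first by exists 1%g.
move=> _ _ [M VM1 ->] [N VN ->]; rewrite pgl2_invgE pgl2_mulgE.
exists (M * N^-1)%g => //; rewrite gl2_val_mul gl2_val_inv; apply: VM => //.
have := Vadj _ VN; rewrite adj2_unit ?gl2_unit // => /(sV (\det N)^-1).
rewrite scalerA mulVf ?scale1r //.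
by have := gl2_unit N; rewrite unitmxE unitfE.
Qed.

(** Since P A = ([simmx P A]) P, this is the matrix of [A], acting on row vectors, in the basis
    formed by the rows of [P]. *)
Definition simmx P A : 'M[K]_2 := gl2_val P *m A *m invmx (gl2_val P).

Lemma simmx1 P : simmx P 1%:M = 1%:M.
Proof. by rewrite /simmx mulmx1 mulmxV // gl2_unit. Qed.

Lemma simmxM P A B : simmx P (A *m B) = simmx P A *m simmx P B.
Proof. by rewrite /simmx !mulmxA mulmxKV // gl2_unit. Qed.

Lemma simmxD P A B : simmx P (A + B) = simmx P A + simmx P B.
Proof. by rewrite /simmx mulmxDr mulmxDl. Qed.

Lemma simmxZ P c A : simmx P (c *: A) = c *: simmx P A.
Proof. by rewrite /simmx -scalemxAr -scalemxAl. Qed.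

Lemma simmxB P A B : simmx P (A - B) = simmx P A - simmx P B.
Proof. by rewrite -scaleN1r simmxD simmxZ scaleN1r. Qed.

Lemma trace_simmx P A : \tr (simmx P A) = \tr A.
Proof. by rewrite /simmx mxtrace_mulC mulmxA mulVmx ?mul1mx // gl2_unit. Qed.

Lemma det_simmx P A : \det (simmx P A) = \det A.
Proof.
rewrite /simmx !det_mulmx mulrC mulrA -det_mulmx mulVmx ?gl2_unit //.
by rewrite det1 mul1r.
Qed.

Lemma simmx_adj2 P A : simmx P (adj2 A) = adj2 (simmx P A).
Proof. by rewrite /adj2 trace_simmx simmxB -scalemx1 simmxZ simmx1 scalemx1. Qed.

Lemma simmxJ P N : simmx P N = gl2_val (P * N * P^-1)%g.
Proof. by []. Qed.

Lemma simmxK P A : invmx (gl2_val P) *m simmx P A *m gl2_val P = A.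
Proof. by rewrite /simmx !mulmxA mulmxKV ?gl2_unit // mulVmx ?mul1mx ?gl2_unit. Qed.

Lemma simmx_inj P : injective (simmx P).
Proof. by move=> A B e; rewrite -(simmxK P A) e simmxK. Qed.

(* The stabilizer of the line spanned by the second row of [P], for the action
   of matrices on row vectors. *)
Definition split_borel P := classes (fun A => simmx P A 1 0 = 0).

(** The name is justified only for the anisotropic [A] introduced below, which have no eigenvalue in
    [K]. *)
Definition nonsplit_torus A := classes (fun B => A *m B = B *m A).

Lemma split_borel_scale P : scale_invariant (fun A => simmx P A 1 0 = 0).
Proof. by move=> c A e; rewrite simmxZ mxE e mulr0. Qed.

Lemma nonsplit_torus_scale A : scale_invariant (fun B => A *m B = B *m A).
Proof. by move=> c B e; rewrite -scalemxAr e scalemxAl. Qed.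

Lemma subgroup_split_borel P : subgroup (split_borel P).
Proof.
apply: subgroup_classes => [||A B|A].
- by rewrite simmx1 mxE.
- exact: split_borel_scale.
- rewrite simmxM; elim/mx2_ind: (simmx P A) => a b c d.
  elim/mx2_ind: (simmx P B) => a' b' c' d'.
  by rewrite mulmx2 !mxE /= => -> ->; ring.
- rewrite simmx_adj2; elim/mx2_ind: (simmx P A) => a b c d.
  by rewrite /adj2 !mxE /= => ->; rewrite subr0.
Qed.

Lemma subgroup_nonsplit_torus A : subgroup (nonsplit_torus A).
Proof.
apply: subgroup_classes => [||B C AB AC|B AB].
- by rewrite mulmx1 mul1mx.
- exact: nonsplit_torus_scale.
- by rewrite mulmxA AB -mulmxA AC mulmxA.
- by rewrite /adj2 mulmxBr mulmxBl AB scalar_mxC.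
Qed.

Lemma closed_split_borel P : closed (split_borel P).
Proof.
(* The entry is rewritten as a product of a constant row, [A] and a constant column, which is
   visibly homogeneous. *)
have -> : split_borel P =
    classes (fun A => row 1 (gl2_val P) *m A *m col 0 (invmx (gl2_val P)) = 0).
  rewrite /split_borel; congr classes; apply/funext => A; apply/propext.
  have -> : row 1 (gl2_val P) *m A *m col 0 (invmx (gl2_val P)) = (simmx P A 1 0)%:M.
    rewrite -row_mul; apply/matrixP=> i j; rewrite !mxE !ord1 mulr1n.
    by apply: eq_bigr => k _; rewrite !mxE.
  split=> [->|/matrixP/(_ 0 0)]; first by rewrite raddf0.
  by rewrite !mxE.
apply: closed_classes; apply: homog_mxM (homog_mx_cst _).
exact: homog_mxM (homog_mx_cst _) (@homog_mx_id _).
Qed.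

Lemma closed_nonsplit_torus A : closed (nonsplit_torus A).
Proof.
have -> : nonsplit_torus A = classes (fun B => A *m B - B *m A = 0).
  rewrite /nonsplit_torus; congr classes; apply/funext => B; apply/propext.
  by split=> [->|/eqP]; [rewrite subrr|rewrite subr_eq0 => /eqP].
apply: (@closed_classes _ 1); apply: homog_mxB.
  exact: (@homog_mxM _ 0 1 _ _ _ _ _ (homog_mx_cst _) (@homog_mx_id _)).
exact: (@homog_mxM _ 1 0 _ _ _ _ _ (@homog_mx_id _) (homog_mx_cst _)).
Qed.

Lemma unit_diag_neq0 (a b d : K) : mx2 a b 0 d \in unitmx -> a != 0 /\ d != 0.
Proof.
by rewrite unitmxE unitfE det_mx2 mulr0 subr0 mulf_eq0 negb_or => /andP.
Qed.

Lemma simmx_upper P A : simmx P A 1 0 = 0 -> exists a b d, simmx P A = mx2 a b 0 d.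
Proof. by move=> e; rewrite (mx2E (simmx P A)) e; do 3 eexists. Qed.

Lemma solvable_split_borel P : is_solvable (split_borel P).
Proof.
(* The invertible matrices in [V] are the scalar multiples of unipotent triangular ones in the basis
   of [P]; their classes form an abelian group containing all commutators. *)
pose V A := exists a b, simmx P A = mx2 a b 0 a.
have sV : scale_invariant V.
  by move=> c A [a [b e]]; exists (c * a), (c * b); rewrite simmxZ e scalemx2 mulr0.
have V1 : V 1%:M by exists 1, 0; rewrite simmx1 scalar_mx2.
have sgV : subgroup (classes V).
  apply: subgroup_classes => // [A B [a [b e]] [a' [b' e']]|A [a [b e]]].
    exists (a * a'), (a * b' + b * a'); rewrite simmxM e e' mulmx2.
    by congr mx2; ring.
  exists a, (- b); rewrite simmx_adj2 e /adj2 trace_mx2 scalar_mx2 oppmx2 addmx2.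
  by congr mx2; ring.
apply: (metabelian_is_solvable (B := classes V)) => //.
- exact: subgroup1.
- move=> x y bx byy; have := subgroupR (subgroup_split_borel P) bx byy.
  case: bx byy => [X /simmx_upper[a [b [d eX]]] ->] [Y /simmx_upper[a' [b' [d' eY]]] ->].
  have -> : [~ pgl2_class X, pgl2_class Y]%g = pgl2_class [~ X, Y]%g.
    by rewrite !commgEl pgl2_conjgE (pgl2_invgE X) (pgl2_mulgE X^-1%g).
  (* In this inverse-free form, comparing diagonals shows that the commutator has diagonal entries
     1. *)
  have : (Y * X * [~ X, Y] = X * Y)%g.
    by rewrite commgEl conjgE !mulgA mulgK mulgV mul1g.
  move: [~ X, Y]%g => Z eXY /(classesE _ (@split_borel_scale P))/simmx_upper[u [v [w eZ]]].
  exists Z => //; move: eXY => /(congr1 (@gl2_val K))/(congr1 (simmx P)).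
  rewrite !gl2_val_mul !simmxM eX eY eZ !mulmx2.
  case/mx2_inj; rewrite !(mul0r, mulr0, addr0, add0r) => e1 _ _ e2.
  have uni N : simmx P N \in unitmx by rewrite simmxJ gl2_unit.
  have [a0 d0] : a != 0 /\ d != 0 by apply: (@unit_diag_neq0 a b); rewrite -eX.
  have [a'0 d'0] : a' != 0 /\ d' != 0 by apply: (@unit_diag_neq0 a' b'); rewrite -eY.
  have u1 : u = 1 by apply: (mulfI (mulf_neq0 a'0 a0)); rewrite e1 mulr1 mulrC.
  have w1 : w = 1 by apply: (mulfI (mulf_neq0 d'0 d0)); rewrite e2 mulr1 mulrC.
  by exists 1, v; rewrite eZ u1 w1.
- move=> _ _ [X [a [b eX]] ->] [Y [a' [b' eY]] ->].
  rewrite /commute (pgl2_mulgE X) (pgl2_mulgE Y); congr pgl2_class.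
  apply: val_inj; apply: (@simmx_inj P).
  rewrite [LHS](simmxM P X Y) [RHS](simmxM P Y X) eX eY !mulmx2.
  by congr mx2; ring.
Qed.

End Subgroups.

(** * The standard subgroups: solvability and connectedness *)

Section StandardSubgroups.
Variables (K : fieldType) (charK0 : [pchar K] =i pred0).
Implicit Types (M N P Q R : GL2 K) (A B : 'M[K]_2).

Let two0 : 2%:R != 0 :> K.
Proof. by move/pcharf0P: charK0 => ->. Qed.

(* The traceless part of [B] is a multiple of [A]. *)
Lemma traceless_commutant A B : \tr A = 0 -> A != 0 -> A *m B = B *m A ->
  exists k, B = (\tr B / 2%:R)%:M + k *: A.
Proof.
elim/mx2_ind: A => p q r s; elim/mx2_ind: B => a b c d.
rewrite trace_mx2 => /eqP; rewrite addrC addr_eq0 => /eqP-> A0.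
rewrite !mulmx2 trace_mx2 scalar_mx2 => /mx2_inj[e1 e2 e3 _].
(* The three equations are the vanishing minors of (p, q, r) and ((a - d)/2, b, c), the coordinates
   of [A] and of the traceless part of [B]. The factor [k] is then read off at a nonzero coordinate
   of [A]. *)
have {}e1 : q * c = b * r by apply: (addrI (p * a)); rewrite e1; ring.
have {}e2 : (a - d) * q = 2%:R * p * b.
  by rewrite mulrBl -[a * q](addrK (b * - p)) -e2; ring.
have {}e3 : (a - d) * r = 2%:R * p * c.
  by rewrite mulrBl [a * r]mulrC -[r * a](addrK (- p * c)) e3; ring.
have half (x y : K) : x - y = 2%:R * (x - (x + y) / 2%:R) by field.
have [q0|q0] := eqVneq q 0; last first.
  exists (b / q); rewrite scalemx2 addmx2.
  have pk : a - (a + d) / 2%:R = b / q * p.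
    apply: (mulfI two0); rewrite -half; apply: (mulIf q0); rewrite e2.
    by field.
  have ck : c = b / q * r by apply: (mulfI q0); rewrite e1; field.
  congr mx2.
  - by rewrite -pk; field.
  - by field.
  - by rewrite add0r.
  - by rewrite mulrN -pk; field.
have [r0|r0] := eqVneq r 0; last first.
  exists (c / r); rewrite scalemx2 addmx2.
  have pk : a - (a + d) / 2%:R = c / r * p.
    apply: (mulfI two0); rewrite -half; apply: (mulIf r0); rewrite e3.
    by field.
  have bk : b = c / r * q by apply: (mulIf r0); rewrite -e1; field.
  congr mx2.
  - by rewrite -pk; field.
  - by rewrite add0r.
  - by field.
  - by rewrite mulrN -pk; field.
have p0 : p != 0.
  by apply: contraNneq A0 => p0; rewrite q0 r0 p0 oppr0 -mx2_0.
have b0 : b = 0.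
  by apply: (mulfI (mulf_neq0 two0 p0)); rewrite -e2 q0 !mulr0.
have c0 : c = 0.
  by apply: (mulfI (mulf_neq0 two0 p0)); rewrite -e3 r0 !mulr0.
exists ((a - d) / (2%:R * p)); rewrite scalemx2 addmx2 b0 c0 q0 r0.
by congr mx2; field; rewrite ?p0 ?two0.
Qed.

(* The characteristic polynomial X^2 + det A has no root in K. *)
Definition anisotropic A := \tr A = 0 /\ forall s, s ^+ 2 <> - \det A.

Lemma anisotropic_neq0 A : anisotropic A -> A != 0.
Proof.
move=> [_ h]; apply/eqP => A0; apply: (h 0).
by rewrite A0 mx2_0 det_mx2 expr0n /= mulr0 subr0 oppr0.
Qed.

Lemma anisotropic_unit A : anisotropic A -> A \in unitmx.
Proof.
move=> [_ h]; rewrite unitmxE unitfE; apply/eqP => d0; apply: (h 0).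
by rewrite d0 expr0n oppr0.
Qed.

(** A triangular matrix of trace zero has diagonal entries [a] and [- a], so [a] would be a square
    root of [- \det A]. *)
Lemma anisotropic_simmx P A : anisotropic A -> simmx P A 1 0 <> 0.
Proof.
move=> [tA h] /simmx_upper[a [b [d e]]]; apply: (h a).
move: tA; rewrite -(trace_simmx P) -(det_simmx P) e trace_mx2 det_mx2.
by move/eqP; rewrite addrC addr_eq0 => /eqP->; ring.
Qed.

(** By [traceless_commutant], [X] is a polynomial in [A]. *)
Lemma commute_anisotropic A (X Y : 'M[K]_2) : anisotropic A ->
  A *m X = X *m A -> A *m Y = Y *m A -> X *m Y = Y *m X.
Proof.
move=> aA AX AY; have A0 := anisotropic_neq0 aA.
have [k ->] := traceless_commutant (proj1 aA) A0 AX.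
by rewrite mulmxDl mulmxDr scalar_mxC -scalemxAl -scalemxAr AY.
Qed.

Lemma solvable_nonsplit_torus A : anisotropic A -> is_solvable (nonsplit_torus A).
Proof.
move=> aA; apply: abelian_is_solvable; first exact: subgroup1 (subgroup_nonsplit_torus A).
move=> _ _ [X AX ->] [Y AY ->]; rewrite /commute (pgl2_mulgE X) (pgl2_mulgE Y).
congr pgl2_class; apply: val_inj; exact: (commute_anisotropic aA AX AY).
Qed.

Lemma connected_split_borel P : connected (split_borel P).
Proof.
apply: connected_linear_classes => // [|A B t eA eB]; first by rewrite simmx1 mxE.
rewrite simmxD simmxZ simmxB; move: (simmx P A) (simmx P B) eA eB => X Y eX eY.
by rewrite !mxE eX eY subr0 mulr0 addr0.
Qed.

Lemma connected_nonsplit_torus A : connected (nonsplit_torus A).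
Proof.
apply: connected_linear_classes => // [|X Y t eX eY]; first by rewrite mulmx1 mul1mx.
by rewrite mulmxDl mulmxDr -scalemxAl -scalemxAr mulmxBl mulmxBr eX eY.
Qed.

Definition standard (T : set (PGL2 K)) :=
  (exists P, T = split_borel P) \/ (exists2 A, anisotropic A & T = nonsplit_torus A).

Lemma standard_closed_connected_solvable T : standard T -> closed_connected_solvable T.
Proof.
case=> [[P ->]|[A aA ->]]; split.
- exact: subgroup_split_borel.
- exact: closed_split_borel.
- exact: connected_split_borel.
- exact: solvable_split_borel.
- exact: subgroup_nonsplit_torus.
- exact: closed_nonsplit_torus.
- exact: connected_nonsplit_torus.
- exact: solvable_nonsplit_torus.
Qed.

(** * Conjugation to [Aff1] and to the tori [torus f] *)

Lemma conjugate_split_borel P : conjugate (pgl2_class P^-1%g) (split_borel P) = Aff1 K.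
Proof.
apply/seteqP; split.
  (* Since [x ^ g] is [g^-1 * x * g], conjugation by the class of [P^-1] is [simmx P]. *)
  move=> _ [_ [N eN ->] <-]; rewrite pgl2_conjgE conjgE invgK mulgA.
  have uN : simmx P N \in unitmx by rewrite simmxJ gl2_unit.
  have [a [b [d e]]] := simmx_upper eN; rewrite e in uN.
  have [a0 d0] := unit_diag_neq0 uN.
  (* Dividing by [d] selects the representative with lower right entry 1. *)
  have uM : mx2 (a / d) (b / d) 0 1 \in unitmx.
    by rewrite unitmxE unitfE det_mx2 mulr0 subr0 mulr1 mulf_neq0 ?invr_eq0.
  exists (MkGL2 uM), (a / d), (b / d); split=> //; first by rewrite mulf_neq0 ?invr_eq0.
  apply/pgl2_class_eq; exists d => //; rewrite -simmxJ e /= scalemx2.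
  by congr mx2; field.
move=> _ [M [a [b [a0 eM ->]]]]; exists (pgl2_class (P^-1 * M * P)%g).
  exists (P^-1 * M * P)%g => //.
  by rewrite simmxJ !mulgA mulgV mul1g mulgK eM mxE.
by rewrite pgl2_conjgE conjgE invgK !mulgA mulgV mul1g mulgK.
Qed.

Lemma conjugate_nonsplit_torus A : anisotropic A ->
  exists g, conjugate g (nonsplit_torus A) = torus (- \det A).
Proof.
move=> aA; have [tA nsq] := aA; pose p := A 0 0; pose q := A 0 1; pose r := A 1 0.
have eA : A = mx2 p q r (- p).
  rewrite [LHS]mx2E; congr mx2; apply/eqP; rewrite -addr_eq0 addrC.
  by rewrite -(trace_mx2 p q r) -mx2E tA.
set f := - \det A in nsq *; have ef : f = p * p + q * r.
  by rewrite /f eA det_mx2; ring.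
(* If [q] were 0, then [p] would be a square root of [f]. So e A = (p, q) and e = (1, 0) are
   independent; they are the rows of [P], and as A^2 = f, the matrix of [A] in this basis is [J]. *)
have q0 : q != 0 by apply/eqP => q0; apply: (nsq p); rewrite ef q0; ring.
have uP : mx2 p q 1 0 \in unitmx.
  by rewrite unitmxE unitfE det_mx2 mulr0 mulr1 sub0r oppr_eq0.
pose P := MkGL2 uP; pose J := mx2 0 f 1 0.
have PA : simmx P A = J.
  rewrite /simmx -[RHS](mulmxK uP); congr (_ *m _).
  by rewrite /= eA !mulmx2 ef; congr mx2; ring.
have Jcomm x y : J *m mx2 x (y * f) y x = mx2 x (y * f) y x *m J.
  by rewrite !mulmx2; congr mx2; ring.
exists (pgl2_class P^-1%g); apply/seteqP; split.
  move=> _ [_ [N AN ->] <-]; rewrite pgl2_conjgE conjgE invgK mulgA.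
  have := congr1 (simmx P) AN; rewrite !simmxM PA simmxJ.
  move: (P * N * P^-1)%g => M; have := mx2E (gl2_val M).
  move: (gl2_val M 0 0) (gl2_val M 0 1) (gl2_val M 1 0) (gl2_val M 1 1).
  move=> a b c d eM; rewrite eM !mulmx2 => /mx2_inj[].
  rewrite !(mul0r, mul1r, mulr0, mulr1, add0r, addr0) => fc fd ab cf.
  exists M, a, c; split=> //; last by rewrite eM -fc ab mulrC.
  apply/negP => /eqP[a0 c0]; have := gl2_unit M.
  by rewrite eM unitmxE unitfE det_mx2 a0 c0 mul0r mulr0 subr0 eqxx.
move=> _ [M [a [b [ab eM ->]]]]; exists (pgl2_class (P^-1 * M * P)%g).
  exists (P^-1 * M * P)%g => //; apply: (@simmx_inj _ P).
  by rewrite (simmxM P A) (simmxM P _ A) PA simmxJ !mulgA mulgV mul1g mulgK eM Jcomm.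
by rewrite pgl2_conjgE conjgE invgK !mulgA mulgV mul1g mulgK.
Qed.

(** * Inclusions between standard subgroups *)

Lemma simmx_mulg P R A : simmx (R * P)%g A = simmx R (simmx P A).
Proof.
rewrite /simmx; have -> : invmx (gl2_val (R * P)%g) = invmx P *m invmx R.
  by rewrite -!gl2_val_inv -gl2_val_mul invgM.
by rewrite gl2_val_mul !mulmxA.
Qed.

(** Only the vanishing of the entry matters, so the adjugate may replace the inverse and make the
    entry polynomial in [R]. *)
Lemma simmx_lower R A : (simmx R A 1 0 == 0) = ((gl2_val R *m A *m adj2 R) 1 0 == 0).
Proof.
rewrite /simmx adj2_unit ?gl2_unit // -scalemxAr [in RHS]mxE mulf_eq0.
by have := gl2_unit R; rewrite unitmxE unitfE => /negbTE->.
Qed.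

Lemma unipotent_unit : mx2 1 1 0 1 \in @unitmx K 2.
Proof. by rewrite unitmxE unitfE det_mx2 mulr0 subr0 mulr1 oner_eq0. Qed.

(** A test element: the only line it fixes is the one spanned by the second row of [P]. *)
Definition unipotent P : GL2 K := (P^-1 * MkGL2 unipotent_unit * P)%g.

Lemma simmx_unipotent P : simmx P (unipotent P) = mx2 1 1 0 1.
Proof. by rewrite simmxJ /unipotent !mulgA mulgV mul1g mulgK. Qed.

Lemma unipotent_split_borel P : split_borel P (pgl2_class (unipotent P)).
Proof. by exists (unipotent P); rewrite ?simmx_unipotent ?mxE. Qed.

(** The unipotent element of [P] fixes a single line, so [P] and [Q] must define the same one. *)
Lemma split_borel_sub_eq P Q :
  split_borel P `<=` split_borel Q -> split_borel P = split_borel Q.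
Proof.
have -> : Q = (Q * P^-1 * P)%g by rewrite mulgVK.
move: (Q * P^-1)%g => R {Q} /(_ _ (unipotent_split_borel P)).
move=> /(classesE _ (@split_borel_scale _ _))/eqP.
rewrite simmx_mulg simmx_unipotent simmx_lower => R10.
rewrite /split_borel; congr classes; apply/funext => A; rewrite simmx_mulg.
apply/propext; suff : (simmx P A 1 0 == 0) = (simmx R (simmx P A) 1 0 == 0).
  by move=> e; split=> /eqP; [rewrite e|rewrite -e] => /eqP.
rewrite (simmx_lower R (simmx P A)); move: R10 (gl2_unit R); rewrite (mx2E (gl2_val R)).
move: (gl2_val R 0 0) (gl2_val R 0 1) (gl2_val R 1 0) (gl2_val R 1 1) => a b c d.
elim/mx2_ind: (simmx P A) => x y z w.
rewrite /adj2 trace_mx2 scalar_mx2 oppmx2 addmx2 !mulmx2 !mxE /=.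
(* The condition on the unipotent element forces the lower left entry [c] of [R] to vanish;
   conjugating by a triangular [R] then only multiplies the entry [z] by a nonzero scalar. *)
have -> : (c * 1 + d * 0) * (a + d - a) + (c * 1 + d * 1) * (0 - c) = - (c * c).
  by ring.
rewrite oppr_eq0 mulf_eq0 orbb => /eqP-> /unit_diag_neq0[_ d0].
have -> : (0 * x + d * z) * (a + d - a) + (0 * y + d * w) * (0 - 0) = d * d * z.
  by ring.
by rewrite !mulf_eq0 (negbTE d0).
Qed.

(** A matrix commuting with the unipotent element preserves its unique fixed line, whereas [A]
    preserves none. *)
Lemma split_borel_not_sub_torus P A : anisotropic A -> ~ split_borel P `<=` nonsplit_torus A.
Proof.
move=> aA /(_ _ (unipotent_split_borel P)) /(classesE _ (@nonsplit_torus_scale _ _)).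
move=> /(congr1 (simmx P)); rewrite (simmxM P A) (simmxM P _ A) simmx_unipotent.
have := anisotropic_simmx (P := P) aA.
elim/mx2_ind: (simmx P A) => a b c d; rewrite mxE /= => c0.
rewrite !mulmx2 => /mx2_inj[+ _ _ _]; rewrite mulr0 mulr1 !mul1r => /addrI/esym.
exact: c0.
Qed.

Lemma mem_nonsplit_torus A (aA : anisotropic A) :
  nonsplit_torus A (pgl2_class (MkGL2 (anisotropic_unit aA))).
Proof. by exists (MkGL2 (anisotropic_unit aA)). Qed.

(** The class of [A] itself lies in the torus and fixes no line. *)
Lemma torus_not_sub_split_borel A P : anisotropic A -> ~ nonsplit_torus A `<=` split_borel P.
Proof.
move=> aA /(_ _ (mem_nonsplit_torus aA))/(classesE _ (@split_borel_scale _ _)).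
exact: anisotropic_simmx.
Qed.

(** The inclusion makes [A] commute with [B]; both being traceless, they are proportional and have
    the same commutant. *)
Lemma nonsplit_torus_sub_eq A B : anisotropic A -> anisotropic B ->
  nonsplit_torus A `<=` nonsplit_torus B -> nonsplit_torus A = nonsplit_torus B.
Proof.
move=> aA aB /(_ _ (mem_nonsplit_torus aA))/(classesE _ (@nonsplit_torus_scale _ _)) /= AB.
have [k] := traceless_commutant (proj1 aB) (anisotropic_neq0 aB) AB.
rewrite (proj1 aA) mul0r -scalemx1 scale0r add0r => eA.
have k0 : k != 0.
  by apply: contraNneq (anisotropic_neq0 aA) => k0; rewrite eA k0 scale0r.
rewrite /nonsplit_torus; congr classes; apply/funext => X; apply/propext.
rewrite eA -scalemxAl -scalemxAr; split=> [|->//].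
by move/(scalerI k0).
Qed.

Lemma standard_sub T T' : standard T -> standard T' -> T `<=` T' -> T = T'.
Proof.
case=> [[P ->]|[A aA ->]]; case=> [[Q ->]|[C aC ->]].
- exact: split_borel_sub_eq.
- by move=> /(split_borel_not_sub_torus aC).
- by move=> /(torus_not_sub_split_borel aA).
- exact: nonsplit_torus_sub_eq.
Qed.

(** * Lines of row vectors: eigenvectors and kernels *)

Lemma fixed_row_split_borel (v : 'rV[K]_2) : v != 0 -> exists P, forall N l,
  v *m gl2_val N = l *: v -> split_borel P (pgl2_class N).
Proof.
move=> v0; have [P vP] : exists P, row 1 (gl2_val P) = v.
  have rv (P : GL2 K) a b : gl2_val P = mx2 a b (v 0 0) (v 0 1) -> row 1 (gl2_val P) = v.
    move=> ->; apply/rowP => i; rewrite !mxE /=.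
    by case: ifPn => [/eqP->//|]; case: i => [[|[|]]]// ? _; congr (v _ _); apply: val_inj.
  (* The first row of [P] is the basis vector for which the determinant is, up to sign, a nonzero
     coordinate of [v]. *)
  have [v00|v00] := eqVneq (v 0 0) 0.
    suff uP : mx2 1 0 (v 0 0) (v 0 1) \in unitmx by exists (MkGL2 uP); exact: rv.
    rewrite unitmxE unitfE det_mx2 v00 mul1r mulr0 subr0.
    apply: contraNneq v0 => v01; apply/eqP/rowP => i; rewrite mxE.
    by case: i => [[|[|]]]// ?; [rewrite -[RHS]v00|rewrite -[RHS]v01];
      congr (v _ _); apply: val_inj.
  suff uP : mx2 0 1 (v 0 0) (v 0 1) \in unitmx by exists (MkGL2 uP); exact: rv.
  by rewrite unitmxE unitfE det_mx2 mul0r mul1r sub0r oppr_eq0.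
exists P => N l vN; exists N => //.
have : row 1 (simmx P N) = l *: row 1 1%:M.
  rewrite /simmx !row_mul vP vN -scalemxAl -vP -row_mul mulmxV ?gl2_unit //.
by move/rowP/(_ 0); rewrite !mxE /= mulr0.
Qed.

(** If [u] and [v] were independent, the matrix [B] with these rows would be invertible and kill
    [A]. *)
Lemma left_kernel_line A (u v : 'rV[K]_2) : A != 0 -> v != 0 ->
  v *m A = 0 -> u *m A = 0 -> exists l, u = l *: v.
Proof.
move=> A0 v0 vA uA; pose B := mx2 (v 0 0) (v 0 1) (u 0 0) (u 0 1).
have rB0 : row 0 B = v.
  apply/rowP => i; rewrite !mxE /=.
  by case: ifPn => [/eqP->//|]; case: i => [[|[|]]]// ? _; congr (v _ _); apply: val_inj.
have rB1 : row 1 B = u.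
  apply/rowP => i; rewrite !mxE /=.
  by case: ifPn => [/eqP->//|]; case: i => [[|[|]]]// ? _; congr (u _ _); apply: val_inj.
have BA : B *m A = 0.
  apply/row_matrixP => i; rewrite row_mul row0.
  by case: i => [[|[|]]]// hi;
    [rewrite (_ : Ordinal hi = 0) ?rB0|rewrite (_ : Ordinal hi = 1) ?rB1] => //;
    apply: val_inj.
have : \det B = 0.
  apply/eqP; apply: contraNT A0 => dB; have uB : B \in unitmx by rewrite unitmxE unitfE.
  by rewrite -(mulKmx uB A) BA mulmx0.
rewrite det_mx2 => /eqP; rewrite subr_eq0 => /eqP e.
have row2 (w : 'rV[K]_2) k : w 0 0 = k * v 0 0 -> w 0 1 = k * v 0 1 -> w = k *: v.
  move=> e0 e1; apply/rowP => i; rewrite mxE.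
  by case: i => [[|[|]]]// hi;
    [rewrite (_ : Ordinal hi = 0) ?e0|rewrite (_ : Ordinal hi = 1) ?e1] => //;
    apply: val_inj.
have [v00|v00] := eqVneq (v 0 0) 0; last first.
  exists (u 0 0 / v 0 0); apply: row2; first by rewrite divfK.
  by apply: (mulfI v00); rewrite e; field.
have v01 : v 0 1 != 0.
  apply: contraNneq v0 => v01; apply/eqP; rewrite -[RHS](scale0r v).
  by apply: row2; rewrite ?v00 ?v01 mul0r.
exists (u 0 1 / v 0 1); apply: row2; last by rewrite divfK.
by apply: (mulfI v01); rewrite -e v00 !(mul0r, mulr0).
Qed.

End StandardSubgroups.

(** * Containment of closed connected solvable subgroups in standard ones *)

Section Classification.
Variables (K : fieldType) (charK0 : [pchar K] =i pred0).
Implicit Types (M N P : GL2 K) (A B : 'M[K]_2) (H : set (PGL2 K)).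

Let two0 : 2%:R != 0 :> K.
Proof. by move/pcharf0P: charK0 => ->. Qed.

Let addrr_eq0 m n (A : 'M[K]_(m, n)) : A + A = 0 -> A = 0.
Proof.
by move/eqP; rewrite -mulr2n -scaler_nat scaler_eq0 (negbTE two0) => /eqP.
Qed.

(* In PGL_2 commuting means commuting up to a scalar, which is a sign by taking
   determinants; both signs are closed conditions on [N], the adjugate replacing
   the inverse to make them polynomial, so connectedness excludes the sign -1. *)
Lemma commutes_with_conjugates H M : connected H -> H 1%g ->
  (forall N, H (pgl2_class N) ->
     commute (pgl2_class M ^ pgl2_class N)%g (pgl2_class M)) ->
  forall N, H (pgl2_class N) ->
    gl2_val (M ^ N)%g *m gl2_val M = gl2_val M *m gl2_val (M ^ N)%g.
Proof.
move=> cH H1 HM N HN.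
(* At an invertible [N], the vanishing of [C M] or of [C (- M)] says that [M ^ N] commutes or
   anticommutes with [M] as a matrix. *)
pose C (B A : 'M[K]_2) :=
  adj2 A *m gl2_val M *m A *m gl2_val M - B *m (adj2 A *m gl2_val M *m A).
have hC B : homog_mx 2 (C B).
  have h : homog_mx 2 (fun A => adj2 A *m gl2_val M *m A).
    apply: (@homog_mxM _ 1 1 _ _ _ _ _ _ (@homog_mx_id _)).
    exact: (@homog_mxM _ 1 0 _ _ _ _ _ (@homog_mx_adj2 _) (homog_mx_cst _)).
  apply: homog_mxB; first exact: (@homog_mxM _ 2 0 _ _ _ _ _ h (homog_mx_cst _)).
  exact: (@homog_mxM _ 0 2 _ _ _ _ _ (homog_mx_cst _) h).
have CE B (X : GL2 K) : C B X =
    \det (gl2_val X) *: (gl2_val (M ^ X)%g *m gl2_val M - B *m gl2_val (M ^ X)%g).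
  rewrite /C adj2_unit ?gl2_unit // scalerBr.
  have -> : gl2_val (M ^ X)%g = invmx X *m gl2_val M *m gl2_val X.
    by rewrite conjgE mulgA.
  by rewrite -!scalemxAl -scalemxAr.
have d0 (X : GL2 K) : \det (gl2_val X) != 0 by rewrite -unitfE -unitmxE gl2_unit.
have CE0 B (X : GL2 K) : C B X = 0 ->
    gl2_val (M ^ X)%g *m gl2_val M = B *m gl2_val (M ^ X)%g.
  by rewrite CE => /eqP; rewrite scaler_eq0 (negbTE (d0 X)) subr_eq0 => /eqP.
apply: (CE0 _ N).
apply: (connected_dichotomy (hC M) (hC (- gl2_val M)) cH H1 _ _ _ HN).
- by rewrite (CE _ 1%g) conjg1 subrr scaler0.
- move=> X HX; rewrite !CE; have := HM X HX.
  rewrite /commute pgl2_conjgE (pgl2_mulgE (M ^ X)%g) (pgl2_mulgE M).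
  move: (M ^ X)%g => Y /pgl2_class_eq[c _]; rewrite !gl2_val_mul => e.
  have /eqP : c ^+ 2 = 1.
    have := congr1 determinant e; rewrite detZ !det_mulmx [\det (gl2_val Y) * _]mulrC.
    by rewrite -[X in X = _]mul1r => /(mulIf (mulf_neq0 (d0 M) (d0 Y)))/esym.
  rewrite sqrf_eq1 => /orP[]/eqP ec; rewrite e ec; [left|right].
    by rewrite scale1r subrr scaler0.
  by rewrite scaleN1r mulNmx subrr scaler0.
- move=> X /CE0 e1 /CE0; rewrite mulNmx -e1 => /eqP; rewrite -subr_eq0 opprK.
  move=> /eqP/addrr_eq0 e.
  have := gl2_unit (M ^ X * M)%g; rewrite gl2_val_mul e unitmxE unitfE mx2_0.
  by rewrite det_mx2 mulr0 subrr eqxx.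
Qed.

(** Each sign is a linear condition on [N], both together would give 2 N A = 0, and the identity
    satisfies the condition with sign +1. *)
Lemma commute_up_to_sign H A : connected H -> H 1%g -> A != 0 ->
  (forall N, H (pgl2_class N) -> A *m gl2_val N = gl2_val N *m A \/
     A *m gl2_val N = - (gl2_val N *m A)) ->
  forall N, H (pgl2_class N) -> A *m gl2_val N = gl2_val N *m A.
Proof.
move=> cH H1 A0 HA N HN.
have hl : homog_mx 1 (fun X : 'M[K]_2 => A *m X).
  exact: (@homog_mxM _ 0 1 _ _ _ _ _ (homog_mx_cst _) (@homog_mx_id _)).
have hr B : homog_mx 1 (fun X : 'M[K]_2 => X *m B).
  exact: (@homog_mxM _ 1 0 _ _ _ _ _ (@homog_mx_id _) (homog_mx_cst _)).
apply/eqP; rewrite -subr_eq0; apply/eqP.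
apply: (connected_dichotomy (homog_mxB hl (hr A)) (homog_mxB hl (hr (- A))) cH H1 _ _ _ HN).
- by rewrite mulmx1 mul1mx subrr.
- by move=> X HX; case: (HA X HX) => ->; [left|right]; rewrite ?mulmxN subrr.
- move=> X /eqP; rewrite subr_eq0 => /eqP->; rewrite mulmxN opprK => /addrr_eq0 XA.
  by move/eqP: A0; apply; rewrite -(mulKmx (gl2_unit X) A) XA mulmx0.
Qed.

Lemma closed_connected_solvable_sub_standard H : closed_connected_solvable H ->
  exists2 T, standard T & H `<=` T.
Proof.
move=> [sH _ cH solH]; have H1 := subgroup1 sH.
have [Htriv|[x]] := solvable_commuting_conjugates sH solH.
  exists (split_borel 1%g); first by left; exists 1%g.
  by move=> x /Htriv ->; exact: subgroup1 (subgroup_split_borel _).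
elim/pgl2_ind: x => M [HM Mn1 cM].
have {cM}MN := commutes_with_conjugates cH H1 (fun N => cM (pgl2_class N)).
pose A := gl2_val M - (\tr (gl2_val M) / 2%:R)%:M.
have tA : \tr A = 0.
  rewrite /A; elim/mx2_ind: (gl2_val M) => a b c d.
  by rewrite scalar_mx2 oppmx2 addmx2 !trace_mx2; field.
have A0 : A != 0.
  apply/negP; rewrite subr_eq0 => /eqP eM; apply: Mn1.
  apply/pgl2_class_eq; exists (\tr (gl2_val M) / 2%:R); last by rewrite {1}eM scalemx1.
  apply: contraTneq (gl2_unit M) => t0.
  by rewrite eM t0 scalar_mx2 unitmxE unitfE det_mx2 mulr0 subrr eqxx.
(* The conjugate [B] of [A] by [N] is traceless and commutes with [A], so it is k A; comparing
   determinants constrains [k]. *)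
have AN N : H (pgl2_class N) -> exists2 k, A *m gl2_val N = k *: (gl2_val N *m A)
    & \det A = k ^+ 2 * \det A.
  move=> HN; pose B := invmx (gl2_val N) *m A *m gl2_val N.
  have eB : B = gl2_val (M ^ N)%g - (\tr (gl2_val M) / 2%:R)%:M.
    rewrite /B /A mulmxBr mulmxBl scalar_mxC mulmxKV ?gl2_unit //.
    by rewrite conjgE mulgA.
  have tB : \tr B = 0 by rewrite /B mxtrace_mulC mulmxA mulmxV ?mul1mx ?gl2_unit.
  have AB : A *m B = B *m A.
    rewrite eB; apply: comm_mxB (comm_mx_scalar _ _); apply: comm_mx_sym.
    by apply: comm_mxB (comm_mx_scalar _ _); exact: MN.
  have [k] := traceless_commutant charK0 tA A0 AB.
  rewrite tB mul0r -scalemx1 scale0r add0r => ek.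
  exists k.
    by rewrite scalemxAr -ek /B !mulmxA mulmxV ?gl2_unit // mul1mx.
  rewrite -detZ -ek /B !det_mulmx mulrC mulrA -det_mulmx mulmxV ?gl2_unit //.
  by rewrite det1 mul1r.
(* The left kernel of [A - s%:M] is a line, and [H] preserves it because it preserves this matrix up
   to scalars. This serves for [s = 0] when [A] is singular and for an eigenvalue [s] otherwise. *)
have stable_line s : \det (A - s%:M) = 0 -> A != s%:M ->
    (forall N, H (pgl2_class N) -> exists2 k, k != 0 &
      (A - s%:M) *m gl2_val N = k *: (gl2_val N *m (A - s%:M))) ->
    exists2 T, standard T & H `<=` T.
  move=> /eqP/det0P[v v0 vA] As HA; have [P HP] := fixed_row_split_borel v0.
  exists (split_borel P); first by left; exists P.
  elim/pgl2_ind=> N HN; have [k k0 eN] := HA N HN.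
  have [||l] := @left_kernel_line _ (A - s%:M) (v *m gl2_val N) v _ v0 vA.
  - by rewrite subr_eq0.
  - apply: (scalerI k0); rewrite scaler0 -mulmxA scalemxAr -eN mulmxA vA.
    by rewrite mul0mx.
  - exact: HP.
have [dA|dA] := eqVneq (\det A) 0.
  apply: (stable_line 0) => [||N HN]; rewrite raddf0 ?subr0 //.
  have [k e _] := AN N HN; exists k => //; apply: contraNneq A0 => k0.
  by rewrite -(mulmxK (gl2_unit N) A) e k0 scale0r mul0mx.
have {}AN N : H (pgl2_class N) -> A *m gl2_val N = gl2_val N *m A.
  apply: commute_up_to_sign => // X HX; have [k -> /esym/eqP] := AN X HX.
  rewrite -subr_eq0 -{2}[\det A]mul1r -mulrBl mulf_eq0 (negbTE dA) orbF subr_eq0.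
  rewrite sqrf_eq1 => /orP[]/eqP->; [left|right]; first by rewrite scale1r.
  by rewrite scaleN1r.
have [[s es]|nsq] := pselect (exists s, s ^+ 2 = - \det A); last first.
  exists (nonsplit_torus A); last by elim/pgl2_ind=> N HN; exists N => //; exact: AN.
  by right; exists A => //; split=> // s es; apply: nsq; exists s.
(* As the trace is zero, [s] is a root of the characteristic polynomial X^2 + det A. If [A] were the
   scalar [s], the trace would force [s = 0], against [dA]. *)
apply: (stable_line s).
- move: es tA; elim/mx2_ind: A {A0 AN stable_line dA} => a b c d.
  rewrite scalar_mx2 oppmx2 addmx2 trace_mx2 !det_mx2 => es.
  move/eqP; rewrite addrC addr_eq0 => /eqP ed; rewrite ed in es *.
  by transitivity (s ^+ 2 - - (a * - a - b * c)); [ring|rewrite es subrr].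
- apply: contraNneq dA => eA; move: tA; rewrite eA scalar_mx2 trace_mx2 det_mx2.
  move/eqP; rewrite -mulr2n -mulr_natl mulf_eq0 (negbTE two0) => /eqP->.
  by rewrite mulr0 subrr.
- move=> N HN; exists 1; rewrite ?oner_neq0 // scale1r mulmxBr mulmxBl AN //.
  by rewrite scalar_mxC.
Qed.

End Classification.

Theorem theorem5p9 (K : fieldType) (charK0 : [pchar K] =i pred0) :
  (forall B : set (PGL2 K), K_Borel B ->
     exists g : PGL2 K,
       conjugate g B = Aff1 K \/
       exists2 f : K, (forall x : K, x ^+ 2 <> f) & conjugate g B = torus f) /\
  (forall H : set (PGL2 K), subgroup H -> closed H -> connected H ->
     is_solvable H -> exists2 B : set (PGL2 K), K_Borel B & H `<=` B).
Proof.
split=> [B [ccsB maxB]|H sH clH cH solH].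
  (* The standard subgroup [T] containing [B] is itself closed, connected and solvable, so
     maximality gives [T = B]. *)
  have [T stT BT] := closed_connected_solvable_sub_standard charK0 ccsB.
  rewrite -(maxB _ (standard_closed_connected_solvable charK0 stT) BT).
  case: stT => [[P ->]|[A aA ->]].
    by exists (pgl2_class P^-1%g); left; exact: conjugate_split_borel.
  have [g gA] := conjugate_nonsplit_torus aA; exists g; right; exists (- \det A) => //.
  by case: aA.
have [T stT HT] := closed_connected_solvable_sub_standard charK0 (And4 sH clH cH solH).
exists T => //; split=> [|H' ccsH' TH'].
  exact: (standard_closed_connected_solvable charK0 stT).
(* Maximality of [T]: a larger [H'] lies in a standard [T'], which must equal [T], so [H'] is
   squeezed between equal sets. *)
have [T' stT' HT'] := closed_connected_solvable_sub_standard charK0 ccsH'.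
have TT' := standard_sub charK0 stT stT' (subset_trans TH' HT').
by apply/seteqP; split=> //; rewrite TT'.
Qed.
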